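(* Suppose each $f_i$ is strongly convex with constant $\mu_i>0$, $i=1,\dots,m$; let $\mu=\min_i\mu_i$, $L_h=(1/\mu)(2+2\cos(\pi/m))$ and $h=-g$. Let $\{\boldsymbol{\lambda}^{(k)}\}_{k\ge0}$ be generated by the inexact dual algorithm with distortions satisfying $\|\mathbf{r}_i^{(k)}\|\le\varepsilon_i$ for all $i,k$ and with stepsizes satisfying $0<\gamma_k\le1/L_h$ for all $k\ge0$ and $\sum_{k=0}^\infty\gamma_k=\infty$. Then: 1. $\displaystyle\limsup_k\ \min_{i\in\{0,\dots,k\}}\|\nabla h(\boldsymbol{\lambda}^{(i)})\|\le\epsilon$. 2. If $\gamma_k=\gamma/(k+1)^p$ with $0<\gamma\le1/L_h$ and $0\le p\le1$, then there is a constant $C$ (independent of $k$) such that for all sufficiently large $k$, $$\min_{i\in\{0,\dots,k\}}\|\nabla h(\boldsymbol{\lambda}^{(i)})\|\le C\,b_k+\epsilon,$$ where $b_k=1/\sqrt{k^{1-p}}$ if $p\in[0,1)$ and $b_k=1/\sqrt{\log k}$ if $p=1$. Among these bounds the best order is $O(1/\sqrt{k})$, achieved when $p=0$, i.e. the fixed stepsize.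
   Context: Let $m\ge2$, $n\ge1$ be integers, $\mathcal{Y}\subseteq\mathbb{R}^n$ a nonempty closed convex set, and $f_i:\mathbb{R}^n\to\mathbb{R}$, $i=1,\dots,m$, strictly convex closed functions. For $\mathbf{y}=(\mathbf{y}_1,\dots,\mathbf{y}_m)\in(\mathbb{R}^n)^m=\mathbb{R}^{nm}$ put $f(\mathbf{y})=\sum_{i=1}^m f_i(\mathbf{y}_i)$, let $\bar{\mathcal{Y}}=\mathcal{Y}^m$, and $\mathbf{A}\mathbf{y}=(\mathbf{y}_1-\mathbf{y}_2,\dots,\mathbf{y}_{m-1}-\mathbf{y}_m)\in\mathbb{R}^{n(m-1)}$. The dual function is $g(\boldsymbol{\lambda})=\inf_{\mathbf{y}\in\bar{\mathcal{Y}}}\big[f(\mathbf{y})+\boldsymbol{\lambda}^{T}\mathbf{A}\mathbf{y}\big]$, $\boldsymbol{\lambda}\in\mathbb{R}^{n(m-1)}$; when all $f_i$ are strongly convex, $g$ is differentiable. Inexact dual algorithm: start from any $\boldsymbol{\lambda}^{(0)}\in\mathbb{R}^{n(m-1)}$; for $k=0,1,2,\dots$ let $\mathbf{y}^{(k)}=\arg\min_{\mathbf{y}\in\bar{\mathcal{Y}}}\big[f(\mathbf{y})+(\boldsymbol{\lambda}^{(k)})^{T}\mathbf{A}\mathbf{y}\big]$, let $\hat{\mathbf{y}}_i^{(k)}=\mathbf{y}_i^{(k)}+\mathbf{r}_i^{(k)}$ where $\mathbf{r}_i^{(k)}\in\mathbb{R}^n$ are arbitrary distortions, let $\hat{\mathbf{d}}^{(k)}=\mathbf{A}\hat{\mathbf{y}}^{(k)}$,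 and set $\boldsymbol{\lambda}^{(k+1)}=\boldsymbol{\lambda}^{(k)}+\gamma_k\hat{\mathbf{d}}^{(k)}$. The distortions are bounded by constants: $\|\mathbf{r}_i^{(k)}\|\le\varepsilon_i$ for all $i$ and $k$, and $\epsilon:=\sqrt{\sum_{i=1}^{m-1}(\varepsilon_i+\varepsilon_{i+1})^2}$. Norms are Euclidean. A function $\varphi$ is strongly convex with constant $\sigma>0$ if $\varphi-\frac{\sigma}{2}\|\cdot\|^2$ is convex. *)

(* Defs.v *)
From HB Require Import structures.
From mathcomp Require Import all_boot all_order all_algebra.
From mathcomp Require Import all_classical all_reals all_analysis.

Set Implicit Arguments.
Unset Strict Implicit.
Unset Printing Implicit Defensive.

Import Order.TTheory GRing.Theory Num.Theory.
Import numFieldNormedType.Exports.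

Local Open Scope classical_set_scope.
Local Open Scope ring_scope.

(* A vector y = (y_1, ..., y_m) of (R^n)^m is the m x n matrix whose rows are
   the blocks y_i; likewise a multiplier of R^(n(m-1)) is an (m-1) x n matrix. *)

(* The norm `|_| of the library is the max norm on matrices, hence: *)
Definition enorm {R : rcfType} {p q : nat} (A : 'M[R]_(p, q)) : R :=
  Num.sqrt (\sum_(i < p) \sum_(j < q) A i j ^+ 2).

Definition edot {R : rcfType} {p q : nat} (A B : 'M[R]_(p, q)) : R :=
  \sum_(i < p) \sum_(j < q) A i j * B i j.

Definition gradient {R : realType} {p q : nat} (h : 'M[R]_(p, q) -> R^o)
    (x : 'M[R]_(p, q)) : 'M[R]_(p, q) :=
  \matrix_(i < p, j < q) 'd h x (delta_mx i j).

Definition strictly_convex {R : realType} {n : nat} (f : 'rV[R]_n -> R) : Prop :=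
  forall (x y : 'rV[R]_n) (t : R), x != y -> 0 < t -> t < 1 ->
    f (t *: x + (1 - t) *: y) < t * f x + (1 - t) * f y.

Definition closed_function {R : realType} {n : nat} (f : 'rV[R]_n -> R) : Prop :=
  closed [set z : 'rV[R]_n * R | f z.1 <= z.2].

Definition strongly_convex {R : realType} {n : nat} (sigma : R)
    (f : 'rV[R]_n -> R) : Prop :=
  convex_function [set: 'rV[R]_n]
    (fun x : 'rV[R]_n => f x - sigma / 2 * enorm x ^+ 2).

(* The link i (0 <= i < m-1) joins the blocks i and i+1. *)
Definition blk_l {m : nat} (i : 'I_m.-1) : 'I_m := widen_ord (leq_pred m) i.

Lemma blk_r_subproof (m : nat) (i : 'I_m.-1) : (i.+1 < m)%N.
Proof. by rewrite -ltn_predRL. Qed.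

Definition blk_r {m : nat} (i : 'I_m.-1) : 'I_m := Ordinal (blk_r_subproof i).

Definition diffop {R : realType} {m n : nat} (y : 'M[R]_(m, n)) :
    'M[R]_(m.-1, n) :=
  \matrix_(i < m.-1) (row (blk_l i) y - row (blk_r i) y).

Definition prodset {R : realType} {m n : nat} (Y : set 'rV[R]_n) :
    set 'M[R]_(m, n) :=
  [set y | forall i : 'I_m, Y (row i y)].

Definition lagrangian {R : realType} {m n : nat} (f : 'I_m -> 'rV[R]_n -> R)
    (y : 'M[R]_(m, n)) (lam : 'M[R]_(m.-1, n)) : R :=
  \sum_(i < m) f i (row i y) + edot lam (diffop y).

Definition dual {R : realType} {m n : nat} (f : 'I_m -> 'rV[R]_n -> R)
    (Y : set 'rV[R]_n) (lam : 'M[R]_(m.-1, n)) : \bar R :=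
  ereal_inf [set (lagrangian f y lam)%:E | y in prodset Y].

(* h = - g; when the f_i are strongly convex and Y is nonempty, closed and
   convex, g is finite and differentiable everywhere, so that neither fine nor
   the total differential in gradient takes a default value. *)
Definition neg_dual {R : realType} {m n : nat} (f : 'I_m -> 'rV[R]_n -> R)
    (Y : set 'rV[R]_n) (lam : 'M[R]_(m.-1, n)) : R^o :=
  - fine (dual f Y lam).

Definition is_argmin {R : realType} {T : Type} (D : set T) (phi : T -> R)
    (x : T) : Prop :=
  D x /\ forall z, D z -> phi x <= phi z.

(* r k is the matrix whose rows are the distortions r_i^(k). *)
Definition inexact_dual_run {R : realType} {m n : nat}
    (f : 'I_m -> 'rV[R]_n -> R) (Y : set 'rV[R]_n) (gam : nat -> R)
    (lam : nat -> 'M[R]_(m.-1, n)) (y r : nat -> 'M[R]_(m, n)) : Prop :=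
  forall k : nat,
    is_argmin (prodset Y) (fun z => lagrangian f z (lam k)) (y k) /\
    lam k.+1 = lam k + gam k *: diffop (y k + r k).

Definition total_eps {R : realType} {m : nat} (eps : 'I_m -> R) : R :=
  Num.sqrt (\sum_(i < m.-1) (eps (blk_l i) + eps (blk_r i)) ^+ 2).

(* The index supplying the unit of the iterated minimum is itself in range. *)
Definition min_const {R : realType} {m : nat} (hm : (2 <= m)%N)
    (mu : 'I_m -> R) : R :=
  \big[Num.min/mu (Ordinal (ltnW hm))]_(i < m) mu i.

Definition lip_const {R : realType} {m : nat} (hm : (2 <= m)%N)
    (mu : 'I_m -> R) : R :=
  1 / min_const hm mu * (2 + 2 * cos (pi / m%:R)).

Definition min_upto {R : realType} (u : nat -> R) (k : nat) : R :=
  \big[Num.min/u 0%N]_(i < k.+1) u i.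

(* Meaningful for k >= 1 (p != 1), resp. k >= 2 (p = 1): otherwise 1 / 0 = 0. *)
Definition rate {R : realType} (p : R) (k : nat) : R^o :=
  if p == 1 then 1 / Num.sqrt (ln (k%:R : R))
  else 1 / Num.sqrt (k%:R `^ (1 - p)).

(* Main.v *)
Require Import Defs.
From HB Require Import structures.
From mathcomp Require Import all_boot all_order all_algebra.
From mathcomp Require Import all_classical all_reals all_analysis.
From mathcomp Require Import ring lra.
Import Order.TTheory GRing.Theory Num.Theory.
Import numFieldNormedType.Exports.
Local Open Scope classical_set_scope.
Local Open Scope ring_scope.

(** If y minimises the Lagrangian at lam, strong convexity makes the Lagrangian
    grow at least like (mu/2) |z - y|^2 away from y; combined with
    |A u|^2 <= (2 + 2 cos (pi/m)) |u|^2 and Young's inequality this gives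
      h(lam) - <d, A y> <= h(lam + d) <= h(lam) - <d, A y> + (L_h/2) |d|^2
    directly from the definition of g as an infimum. Hence h is differentiable at
    lam with gradient - A y (whether or not minimisers exist at nearby
    multipliers), and a step of size t <= 1/L_h in the direction A y + e
    decreases h by at least (t/2) (|A y|^2 - |e|^2). As h is bounded below by the
    value at a consensus point, the weighted sums of |grad h|^2 - eps^2 are
    bounded by some D, so the best gradient norm is at most
    eps + sqrt (D / (gam_0 + ... + gam_k)). *)

Section Euclidean.
Context {R : rcfType} {p q : nat}.
Implicit Types (A B C : 'M[R]_(p, q)) (c : R).

Lemma edotC A B : edot A B = edot B A.
Proof. by apply: eq_bigr => i _; apply: eq_bigr => j _; rewrite mulrC. Qed.

Lemma edotDr A B C : edot A (B + C) = edot A B + edot A C.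
Proof.
rewrite /edot -big_split; apply: eq_bigr => i _.
by rewrite -big_split; apply: eq_bigr => j _; rewrite mxE mulrDr.
Qed.

Lemma edotZr c A B : edot A (c *: B) = c * edot A B.
Proof.
rewrite /edot mulr_sumr; apply: eq_bigr => i _.
by rewrite mulr_sumr; apply: eq_bigr => j _; rewrite mxE; ring.
Qed.

Lemma edotDl A B C : edot (A + B) C = edot A C + edot B C.
Proof. by rewrite edotC edotDr !(edotC C). Qed.

Lemma edotZl c A B : edot (c *: A) B = c * edot A B.
Proof. by rewrite edotC edotZr edotC. Qed.

Lemma edotNr A B : edot A (- B) = - edot A B.
Proof. by rewrite -scaleN1r edotZr mulN1r. Qed.

Lemma edotNl A B : edot (- A) B = - edot A B.
Proof. by rewrite edotC edotNr edotC. Qed.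

Lemma edot_ge0 A : 0 <= edot A A.
Proof.
by apply: sumr_ge0 => i _; apply: sumr_ge0 => j _; rewrite -expr2 sqr_ge0.
Qed.

Lemma edot_delta A (i : 'I_p) (j : 'I_q) : edot A (delta_mx i j) = A i j.
Proof.
rewrite /edot (bigD1 i)//= (bigD1 j)//= mxE !eqxx mulr1 !big1 ?addr0//.
- move=> k ki; rewrite big1// => l _.
  by rewrite mxE (negbTE ki) mulr0.
- by move=> l lj; rewrite mxE (negbTE lj) andbF mulr0.
Qed.

Lemma enormE A : enorm A = Num.sqrt (edot A A).
Proof.
by congr Num.sqrt; apply: eq_bigr => i _; apply: eq_bigr => j _; rewrite expr2.
Qed.

Lemma sqr_enorm A : enorm A ^+ 2 = edot A A.
Proof. by rewrite enormE sqr_sqrtr// edot_ge0. Qed.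

Lemma enorm_ge0 A : 0 <= enorm A.
Proof. exact: sqrtr_ge0. Qed.

Lemma enormN A : enorm (- A) = enorm A.
Proof. by rewrite !enormE edotNl edotNr opprK. Qed.

Lemma edot_self_eq0 A : edot A A = 0 -> A = 0.
Proof.
move=> /eqP; rewrite psumr_eq0 => [/allP A0|i _]; last first.
  by apply: sumr_ge0 => j _; rewrite -expr2 sqr_ge0.
apply/matrixP => i j; rewrite mxE.
have := A0 i (mem_index_enum _); rewrite psumr_eq0 => [/allP Ai0|k _].
  by have := Ai0 j (mem_index_enum _); rewrite -expr2 sqrf_eq0 => /eqP.
by rewrite -expr2 sqr_ge0.
Qed.

Lemma edot_le_enorm A B : edot A B <= enorm A * enorm B.
Proof.
have [a0 b0] := (enorm_ge0 A, enorm_ge0 B).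
have [AB0|ABn0] := eqVneq (enorm A * enorm B) 0.
  suff -> : edot A B = 0 by rewrite mulr_ge0.
  move/eqP: AB0; rewrite mulf_eq0 => /orP[] /eqP E.
    rewrite [A]edot_self_eq0 -?sqr_enorm ?E ?expr0n//.
    by rewrite -(scale0r 0) edotZl mul0r.
  rewrite [B]edot_self_eq0 -?sqr_enorm ?E ?expr0n//.
  by rewrite -(scale0r 0) edotZr mul0r.
have ABp : 0 < enorm A * enorm B by rewrite lt_def ABn0 mulr_ge0.
have := edot_ge0 (enorm B *: A - enorm A *: B).
rewrite !(edotDl, edotDr, edotNl, edotNr, edotZl, edotZr) -!sqr_enorm.
rewrite (edotC B A).
rewrite (_ : _ + _ =
  2 * (enorm A * enorm B) * (enorm A * enorm B - edot A B)); last ring.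
by rewrite pmulr_rge0 ?subr_ge0// mulr_gt0.
Qed.

Lemma enorm_triangle A B : enorm (A + B) <= enorm A + enorm B.
Proof.
rewrite -ler_sqr ?nnegrE ?addr_ge0 ?enorm_ge0// sqr_enorm edotDl !edotDr.
rewrite -!sqr_enorm (edotC B A) sqrrD.
by have := edot_le_enorm A B; lra.
Qed.

Lemma edot_young c A B : 0 < c ->
  - (c / 2 * edot A A + c^-1 / 2 * edot B B) <= edot A B.
Proof.
move=> c0; have := edot_ge0 (c *: A + B).
rewrite edotDl !edotDr !(edotZl, edotZr) (edotC B A) => H.
rewrite -subr_ge0 (_ : _ - _ = (2 * c)^-1 *
  (c * (c * edot A A) + c * edot A B + (c * edot A B + edot B B))).
  by rewrite mulr_ge0// invr_ge0 mulr_ge0// ltW.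
by field; rewrite gt_eqF.
Qed.

End Euclidean.

Lemma sqr_enorm_sum_row {R : rcfType} {p q : nat} (A : 'M[R]_(p, q)) :
  edot A A = \sum_(i < p) enorm (row i A) ^+ 2.
Proof.
apply: eq_bigr => i _; rewrite sqr_enorm /edot big_ord1.
by apply: eq_bigr => j _; rewrite !mxE.
Qed.

Lemma edot_le_mx_norm {R : realType} {p q : nat} (A : 'M[R]_(p, q)) :
  edot A A <= (p%:R * q%:R) * `|A| ^+ 2.
Proof.
rewrite /edot; apply: (@le_trans _ _ (\sum_(i < p) \sum_(j < q) `|A| ^+ 2)).
  apply: ler_sum => i _; apply: ler_sum => j _.
  rewrite -expr2 -real_normK ?num_real// ler_sqr ?nnegrE//.
  rewrite [leRHS]mx_normrE; exact: (le_bigmax _ _ (i, j)).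
by rewrite !sumr_const !card_ord -mulrnA mulnC -natrM mulr_natl.
Qed.

(* The weights sin ((i + 1/2) pi / m.+1) form, up to alternating signs, the top
   eigenvector of the Laplacian of the path with m.+1 vertices. *)
Lemma path_laplacian_le {R : realType} (m : nat) (u : 'I_m.+1 -> R) :
  \sum_(i < m) (u (widen_ord (leqnSn m) i) - u (lift ord0 i)) ^+ 2 <=
  (2 + 2 * cos (pi / m.+1%:R)) * \sum_(i < m.+1) u i ^+ 2.
Proof.
set th : R := pi / m.+1%:R.
have thE : m.+1%:R * th = pi by rewrite /th mulrC divfK// pnatr_eq0.
have th0 : 0 < th by rewrite divr_gt0 ?pi_gt0.
pose w (x : R) := sin ((x + 2^-1) * th).
have wgt0 (i : nat) : (i < m.+1)%N -> 0 < w i%:R.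
  move=> im; apply: sin_gt0_pi; rewrite mulr_gt0//=.
  rewrite -thE ltr_pM2r// (@lt_le_trans _ _ (i%:R + 1))//.
    by rewrite ltrD2l; lra.
  by rewrite natr1 ler_nat.
have w_rec x : w (x + 1) + w (x - 1) = 2 * cos th * w x.
  rewrite /w; set a := (x + 2^-1) * th.
  rewrite (_ : (x + 1 + 2^-1) * th = a + th); last by rewrite /a; ring.
  rewrite (_ : (x - 1 + 2^-1) * th = a - th); last by rewrite /a; ring.
  by rewrite sinB sinD; ring.
have w_last : w m.+1%:R = - w m%:R.
  rewrite /w (_ : (m.+1%:R + _) * th = th / 2 + pi); last first.
    by rewrite -thE; field.
  rewrite (_ : (m%:R + _) * th = - (th / 2) + pi); last first.
    by rewrite -thE -natr1; field.
  by rewrite !sinDpi sinN opprK.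
have w_first : w (0 - 1) = - w 0.
  by rewrite /w -sinN; congr sin; field.
pose a (i : 'I_m.+1) := (1 + w (i.+1)%:R / w i%:R) * u i ^+ 2.
pose b (i : 'I_m.+1) := (1 + w (i%:R - 1) / w i%:R) * u i ^+ 2.
have ab i : a i + b i = (2 + 2 * cos th) * u i ^+ 2.
  rewrite /a /b -mulrDl; congr (_ * _).
  have /gt_eqF wi := wgt0 i (ltn_ord i).
  rewrite -natr1 addrACA -mulrDl w_rec mulfK ?wi//.
rewrite mulr_sumr.
under [leRHS]eq_bigr do rewrite -ab.
rewrite big_split/= [X in X + _]big_ord_recr [X in _ + X]big_ord_recl/=.
have -> : a ord_max = 0.
  by rewrite /a /= w_last mulNr divff ?gt_eqF ?wgt0// subrr mul0r.
have -> : b ord0 = 0.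
  by rewrite /b /= w_first mulNr divff ?gt_eqF ?(wgt0 0%N)// subrr mul0r.
rewrite addr0 add0r -big_split/=; apply: ler_sum => i _.
rewrite /a /b /= /bump /= add1n.
set x := u _; set y := u _.
have wi : 0 < w i%:R by rewrite wgt0// ltnW// ltnS.
have wi1 : 0 < w i.+1%:R by rewrite wgt0// ltnS.
rewrite (_ : i.+1%:R - 1 = i%:R); last by rewrite -natr1 addrK.
rewrite -subr_ge0.
rewrite (_ : _ - _ =
  (w i%:R * w i.+1%:R)^-1 * (w i.+1%:R * x + w i%:R * y) ^+ 2).
  by rewrite mulr_ge0 ?sqr_ge0// invr_ge0 mulr_ge0// ltW.
by field; rewrite !gt_eqF.
Qed.

Section DifferenceOperator.
Context {R : realType} {m n : nat}.
Implicit Types (y z : 'M[R]_(m, n)).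

Lemma diffopD y z : diffop (y + z) = diffop y + diffop z.
Proof. by apply/matrixP => i j; rewrite !mxE; ring. Qed.

Lemma diffopZ (c : R) y : diffop (c *: y) = c *: diffop y.
Proof. by apply/matrixP => i j; rewrite !mxE; ring. Qed.

Lemma diffopB y z : diffop (y - z) = diffop y - diffop z.
Proof. by apply/matrixP => i j; rewrite !mxE; ring. Qed.

Lemma sqr_diffop_le y :
  edot (diffop y) (diffop y) <= (2 + 2 * cos (pi / m%:R)) * edot y y.
Proof.
case: m y => [|m'] y.
  rewrite /edot !big_ord0 mulr0; exact: lexx.
rewrite /edot exchange_big/= [X in _ * X]exchange_big/= mulr_sumr.
apply: ler_sum => j _; have := path_laplacian_le m' (fun i => y i j).
under [X in _ * X]eq_bigr do rewrite expr2.
apply: le_trans; rewrite le_eqVlt; apply/orP; left; apply/eqP/eq_bigr => i _.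
rewrite !mxE expr2.
have -> : @blk_l m'.+1 i = widen_ord (leqnSn m') i by exact: val_inj.
by have -> : @blk_r m'.+1 i = lift ord0 i by exact: val_inj.
Qed.

Lemma enorm_diffop_le_total_eps (eps : 'I_m -> R) y :
  (forall i, enorm (row i y) <= eps i) -> enorm (diffop y) <= total_eps eps.
Proof.
move=> yeps; rewrite enormE ler_sqrt; last first.
  by apply: sumr_ge0 => i _; exact: sqr_ge0.
rewrite sqr_enorm_sum_row; apply: ler_sum => i _.
have e0 i' : 0 <= eps i' := le_trans (enorm_ge0 _) (yeps i').
rewrite ler_sqr ?nnegrE ?enorm_ge0 ?addr_ge0// rowK.
by rewrite (le_trans (enorm_triangle _ _))// enormN lerD.
Qed.

End DifferenceOperator.

Lemma edot_conv {R : rcfType} {p q : nat} (t : R) (A B : 'M[R]_(p, q)) :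
  edot (t *: A + (1 - t) *: B) (t *: A + (1 - t) *: B) =
  t * edot A A + (1 - t) * edot B B - t * (1 - t) * edot (A - B) (A - B).
Proof.
rewrite !(edotDl, edotDr, edotNl, edotNr, edotZl, edotZr) (edotC B A); ring.
Qed.

Lemma strongly_convex_conv {R : realType} {n : nat} (s : R) (f : 'rV[R]_n -> R)
    (t : R) (x z : 'rV[R]_n) : strongly_convex s f -> 0 <= t -> t <= 1 ->
  f (t *: x + (1 - t) *: z) <=
  t * f x + (1 - t) * f z - s / 2 * (t * (1 - t) * edot (x - z) (x - z)).
Proof.
move=> sf t0 t1; have := sf (Itv01 t0 t1) x z (in_setT _) (in_setT _).
rewrite convRE /conv /= /convex.conv /= /unstable.onem.
rewrite !sqr_enorm edot_conv => H.
rewrite -subr_ge0; move: H; rewrite -subr_ge0; congr (0 <= _); ring.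
Qed.

Section DualFunction.
Context {R : realType} {m n : nat} (f : 'I_m -> 'rV[R]_n -> R).
Context (Y : set 'rV[R]_n).
Hypothesis Ycv : convex_set Y.
Context (mu : 'I_m -> R).
Hypothesis fmu : forall i, strongly_convex (mu i) (f i).
Context (c L : R).
Hypothesis c_le : forall i, c <= mu i.
Hypothesis L_gt0 : 0 < L.
Hypothesis cL : 2 + 2 * cos (pi / m%:R) <= c * L.
Implicit Types (lam dl : 'M[R]_(m.-1, n)) (y z : 'M[R]_(m, n)).

Lemma prodset_conv (t : R) y z : 0 <= t -> t <= 1 ->
  prodset Y y -> prodset Y z -> prodset Y (t *: y + (1 - t) *: z).
Proof.
move=> t0 t1 Yy Yz i; rewrite linearD !linearZ/=.
by have := Ycv _ _ (Itv01 t0 t1) (mem_set (Yy i)) (mem_set (Yz i)); rewrite inE.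
Qed.

Lemma lagrangian_conv (t : R) lam y z : 0 <= t -> t <= 1 ->
  lagrangian f (t *: y + (1 - t) *: z) lam <=
  t * lagrangian f y lam + (1 - t) * lagrangian f z lam
  - c / 2 * (t * (1 - t) * edot (y - z) (y - z)).
Proof.
move=> t0 t1; rewrite /lagrangian diffopD !diffopZ edotDr !edotZr.
suff : \sum_(i < m) f i (row i (t *: y + (1 - t) *: z)) <=
    t * (\sum_(i < m) f i (row i y)) + (1 - t) * (\sum_(i < m) f i (row i z))
    - c / 2 * (t * (1 - t) * edot (y - z) (y - z)) by lra.
rewrite sqr_enorm_sum_row !mulr_sumr -big_split/= -sumrB; apply: ler_sum => i _.
have -> : row i (t *: y + (1 - t) *: z) = t *: row i y + (1 - t) *: row i z.
  by apply/rowP => j; rewrite !mxE.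
apply: le_trans (strongly_convex_conv _ _ _ _ _ (fmu i) t0 t1) _.
have -> : row i y - row i z = row i (y - z) by apply/rowP => j; rewrite !mxE.
rewrite -sqr_enorm lerD2l lerN2 ler_wpM2r ?ler_pM2r//.
by rewrite mulr_ge0 ?sqr_ge0// mulr_ge0// subr_ge0.
Qed.

(* Compare y with the points t z + (1 - t) y and let t tend to 0. *)
Lemma argmin_quadratic_growth lam y z :
  is_argmin (prodset Y) (fun z => lagrangian f z lam) y -> prodset Y z ->
  lagrangian f y lam + c / 2 * edot (z - y) (z - y) <= lagrangian f z lam.
Proof.
move=> [Yy ymin] Yz.
set a := lagrangian f y lam; set b := lagrangian f z lam.
set q := c / 2 * edot _ _.
have step t : 0 < t -> t < 1 -> a + (1 - t) * q <= b.
  move=> t0 t1; have [t0' t1'] := (ltW t0, ltW t1).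
  have := le_trans (ymin _ (prodset_conv _ _ _ t0' t1' Yz Yy))
                   (lagrangian_conv _ lam z y t0' t1').
  rewrite -/a -/b => H; rewrite -(ler_pM2l t0) -subr_ge0.
  by move: H; rewrite -subr_ge0 /q; congr (0 <= _); ring.
rewrite leNgt; apply/negP => blt.
have q0 : 0 < q.
  rewrite ltNge; apply/negP => q0.
  have := step 2^-1 ltac:(lra) ltac:(lra); have := ymin _ Yz.
  by rewrite -/a -/b; lra.
pose t := Num.min 2^-1 ((a + q - b) / 2 / q).
have t0 : 0 < t.
  by rewrite lt_min invr_gt0 ltr0n/= !divr_gt0// subr_gt0.
have t1 : t < 1 by rewrite gt_min; apply/orP; left; lra.
have tq : t * q <= (a + q - b) / 2 by rewrite -ler_pdivlMr// ge_min lexx orbT.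
have := step t t0 t1; move: blt tq.
by lra.
Qed.

Lemma lagrangianDr y lam dl :
  lagrangian f y (lam + dl) = lagrangian f y lam + edot dl (diffop y).
Proof. by rewrite /lagrangian edotDl addrA. Qed.

Lemma dual_le_tangent lam dl y : prodset Y y ->
  (dual f Y (lam + dl) <= (lagrangian f y lam + edot dl (diffop y))%:E)%E.
Proof.
by move=> Yy; rewrite -lagrangianDr; apply: ereal_inf_lbound; exists y.
Qed.

Lemma dual_ge_quadratic lam dl y :
  is_argmin (prodset Y) (fun z => lagrangian f z lam) y ->
  ((lagrangian f y lam + edot dl (diffop y) - L / 2 * edot dl dl)%:E <=
   dual f Y (lam + dl))%E.
Proof.
move=> ymin; apply/ereal_infP => _ [z Yz <-].
rewrite lee_fin lagrangianDr.
have growth := argmin_quadratic_growth _ _ _ ymin Yz.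
have := edot_young L dl (diffop (z - y)) L_gt0.
have : L^-1 / 2 * edot (diffop (z - y)) (diffop (z - y)) <=
       c / 2 * edot (z - y) (z - y).
  have -> : c / 2 * edot (z - y) (z - y) =
            L^-1 / 2 * (c * L * edot (z - y) (z - y)).
    by field; rewrite gt_eqF.
  rewrite ler_pM2l ?divr_gt0 ?invr_gt0//.
  by rewrite (le_trans (sqr_diffop_le _))// ler_wpM2r// edot_ge0.
have -> : edot dl (diffop (z - y)) = edot dl (diffop z) - edot dl (diffop y).
  by rewrite diffopB edotDr edotNr.
by lra.
Qed.

Lemma neg_dual_argmin lam y :
  is_argmin (prodset Y) (fun z => lagrangian f z lam) y ->
  neg_dual f Y lam = - lagrangian f y lam.
Proof.
move=> [Yy ymin]; congr (- _); rewrite -[RHS]/(fine (_%:E)); congr fine.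
apply/eqP; rewrite eq_le; apply/andP; split.
  by apply: ereal_inf_lbound; exists y.
by apply/ereal_infP => _ [z Yz <-]; rewrite lee_fin ymin.
Qed.

Lemma neg_dual_quadratic_bounds lam dl y :
  is_argmin (prodset Y) (fun z => lagrangian f z lam) y ->
  neg_dual f Y lam - edot dl (diffop y) <= neg_dual f Y (lam + dl)
  <= neg_dual f Y lam - edot dl (diffop y) + L / 2 * edot dl dl.
Proof.
move=> ymin; rewrite (neg_dual_argmin _ _ ymin).
have := dual_le_tangent lam dl _ (proj1 ymin).
have := dual_ge_quadratic lam dl _ ymin.
rewrite /neg_dual; case: (dual _ _ _) => [g| |]//.
by rewrite !lee_fin /=; lra.
Qed.

Lemma gradient_neg_dual lam y :
  is_argmin (prodset Y) (fun z => lagrangian f z lam) y ->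
  gradient (neg_dual f Y) lam = - diffop y.
Proof.
move=> ymin.
pose df := fun dl => - edot dl (diffop y) : R^o.
have df_lin : linear df.
  by move=> k A B; rewrite /df edotDl edotZl opprD -mulrN.
pose dfM := GRing.isLinear.Build R _ _ *:%R df df_lin.
pose dfL : {linear 'M[R]_(m.-1, n) -> R^o} := HB.pack df dfM.
suff diffE : 'd (neg_dual f Y) lam = dfL :> (_ -> _).
  apply/matrixP => i j; rewrite [LHS]mxE [RHS]mxE diffE /= /df.
  by rewrite edotC edot_delta.
have dfc : continuous dfL.
  have edot_cont :
      continuous (fun A : 'M[R]_(m.-1, n) => edot A (diffop y) : R^o).
    apply: (@continuous_big R^o) => [|i _]; first exact: add_continuous.
    apply: (@continuous_big R^o) => [|j _]; first exact: add_continuous.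
    move=> x; apply: (@cvgM _ _ (nbhs x) _ (fun A : 'M[R]_(m.-1, n) => A i j)).
      exact: coord_continuous.
    exact: cvg_cst.
  by move=> x; apply: (@cvgN _ _ _ (nbhs x)); exact: edot_cont.
apply: diff_unique => //.
apply/eqaddoP => e e0.
pose K : R := L / 2 * (m.-1%:R * n%:R) + 1.
have K0 : 0 < K by rewrite ltr_wpDl// mulr_ge0// divr_ge0// ltW.
have small : \forall x \near (0 : 'M[R]_(m.-1, n)), `|x| <= K^-1 * e.
  by apply: nbhs0_le; rewrite mulr_gt0// invr_gt0.
near=> dl.
rewrite -[X in `|X|]/(neg_dual f Y (dl + lam) -
  (neg_dual f Y lam - edot dl (diffop y))) [dl + lam]addrC.
have := neg_dual_quadratic_bounds lam dl y ymin.
move=> /andP[lb ub].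
apply: (@le_trans _ _ (K * `|dl| ^+ 2)); last first.
  rewrite expr2 mulrA ler_wpM2r// -ler_pdivlMl//.
  by near: dl; exact: small.
have dl2 : L / 2 * edot dl dl <= K * `|dl| ^+ 2.
  have L2 : 0 <= L / 2 by rewrite divr_ge0// ltW.
  apply: le_trans (ler_wpM2l L2 (edot_le_mx_norm dl)) _.
  by rewrite -subr_ge0 (_ : _ - _ = `|dl| ^+ 2) ?sqr_ge0// /K; ring.
have := edot_ge0 dl.
rewrite ger0_norm; first by move: lb ub dl2; lra.
by move: lb; lra.
Unshelve. all: by end_near.
Qed.

End DualFunction.

Section InexactDescent.
Context {R : realType} {m n : nat} (f : 'I_m -> 'rV[R]_n -> R).
Context (Y : set 'rV[R]_n).
Hypothesis Y0 : Y !=set0.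
Hypothesis Ycv : convex_set Y.
Context (mu : 'I_m -> R).
Hypothesis fmu : forall i, strongly_convex (mu i) (f i).
Context (c L : R).
Hypothesis c_le : forall i, c <= mu i.
Hypothesis L_gt0 : 0 < L.
Hypothesis cL : 2 + 2 * cos (pi / m%:R) <= c * L.

Lemma neg_dual_descent (lam : 'M[R]_(m.-1, n)) (y r : 'M[R]_(m, n)) (t E : R) :
  is_argmin (prodset Y) (fun z => lagrangian f z lam) y ->
  enorm (diffop r) <= E -> 0 < t -> t * L <= 1 ->
  t * (enorm (gradient (neg_dual f Y) lam) ^+ 2 - E ^+ 2) <=
  2 * (neg_dual f Y lam - neg_dual f Y (lam + t *: diffop (y + r))).
Proof.
move=> ymin rE t0 tL.
rewrite (gradient_neg_dual f Y Ycv mu fmu c L c_le L_gt0 cL lam y ymin).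
have /andP[_] := neg_dual_quadratic_bounds f Y Ycv mu fmu c L c_le L_gt0 cL
  lam (t *: diffop (y + r)) y ymin.
rewrite enormN sqr_enorm diffopD.
rewrite !(edotDl, edotDr, edotNl, edotNr, edotZl, edotZr).
rewrite (edotC (diffop r) (diffop y)).
set d := edot (diffop y) (diffop y); set de := edot (diffop y) (diffop r).
set e := edot (diffop r) (diffop r).
have eE : e <= E ^+ 2.
  rewrite /e -sqr_enorm ler_sqr ?nnegrE ?enorm_ge0//.
  exact: le_trans (enorm_ge0 _) rE.
have : 0 <= d + de + (de + e).
  rewrite /d /de /e -!edotDr (edotC (diffop y) (diffop r)).
  by rewrite -edotDr -edotDl edot_ge0.
set h0 := neg_dual _ _ _; set h1 := neg_dual _ _ _ => q0 hh.
have teE : t * e <= t * E ^+ 2 by rewrite ler_pM2l.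
have : t * L * (t * (d + de + (de + e))) <= 1 * (t * (d + de + (de + e))).
  by rewrite ler_wpM2r// mulr_ge0// ltW.
by move: hh teE; lra.
Qed.

Lemma neg_dual_ge (y0 : 'rV[R]_n) (lam : 'M[R]_(m.-1, n)) (y : 'M[R]_(m, n)) :
  Y y0 -> is_argmin (prodset Y) (fun z => lagrangian f z lam) y ->
  - (\sum_(i < m) f i y0) <= neg_dual f Y lam.
Proof.
move=> Yy0 ymin; rewrite (neg_dual_argmin f Y lam y ymin) lerN2.
pose z := \matrix_(i < m) y0.
have rowz i : row i z = y0 by rewrite rowK.
have Yz : prodset Y z by move=> i; rewrite rowz.
have := proj2 ymin z Yz.
have dz : diffop z = 0 by apply/matrixP => i j; rewrite !mxE subrr.
have -> : lagrangian f z lam = edot lam (diffop z) + \sum_(i < m) f i y0.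
  rewrite /lagrangian addrC; congr (_ + _).
  by apply: eq_bigr => i _; rewrite rowz.
by rewrite dz -(scale0r 0) edotZr mul0r add0r.
Qed.

Lemma run_sum_bound (gam : nat -> R) (lam : nat -> 'M[R]_(m.-1, n))
    (y r : nat -> 'M[R]_(m, n)) (E : R) :
  inexact_dual_run f Y gam lam y r ->
  (forall k, enorm (diffop (r k)) <= E) ->
  (forall k, 0 < gam k /\ gam k * L <= 1) ->
  exists2 D : R, 0 <= D & forall k,
    \sum_(i < k) gam i *
      (enorm (gradient (neg_dual f Y) (lam i)) ^+ 2 - E ^+ 2) <= D.
Proof.
move=> run rE hgam; case: Y0 => y0 Yy0.
have hge k := neg_dual_ge y0 (lam k) (y k) Yy0 (proj1 (run k)).
exists (2 * (neg_dual f Y (lam 0%N) + \sum_(i < m) f i y0)).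
  by rewrite mulr_ge0// -lerBlDr sub0r.
move=> k.
suff : \sum_(i < k) gam i *
      (enorm (gradient (neg_dual f Y) (lam i)) ^+ 2 - E ^+ 2) <=
    2 * (neg_dual f Y (lam 0%N) - neg_dual f Y (lam k)).
  by have := hge k; lra.
elim: k => [|k IH]; first by rewrite big_ord0 subrr mulr0.
rewrite big_ord_recr/=.
have [ymin lamS] := run k; have [g0 g1] := hgam k.
have := neg_dual_descent (lam k) (y k) (r k) (gam k) E ymin (rE k) g0 g1.
by rewrite -lamS; move: IH; lra.
Qed.

End InexactDescent.

Section BestIterate.
Context {R : realType}.
Implicit Types (u gam : nat -> R).

Lemma min_upto_le u k i : (i <= k)%N -> min_upto u k <= u i.
Proof.
rewrite -ltnS => ik; exact: (bigmin_inf (Ordinal ik)).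
Qed.

Lemma min_upto_ge0 u k : (forall i, 0 <= u i) -> 0 <= min_upto u k.
Proof. by move=> u0; apply: le_bigmin. Qed.

Lemma min_upto_le_sqrt u gam (D E : R) k : (forall i, 0 <= u i) -> 0 <= E ->
  (forall i, 0 < gam i) -> 0 <= D ->
  \sum_(i < k.+1) gam i * (u i ^+ 2 - E ^+ 2) <= D ->
  min_upto u k <= Num.sqrt (D / \sum_(i < k.+1) gam i) + E.
Proof.
move=> u0 E0 gam0 D0 sumD; set S := \sum_(i < _) gam i.
have S0 : 0 < S.
  by rewrite /S big_ord_recl ltr_pwDl// sumr_ge0// => i _; exact: ltW.
have DS0 : 0 <= D / S by rewrite divr_ge0// ltW.
have M0 := min_upto_ge0 u k u0.
rewrite -ler_sqr ?nnegrE ?addr_ge0 ?sqrtr_ge0// sqrrD sqr_sqrtr//.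
suff : min_upto u k ^+ 2 - E ^+ 2 <= D / S.
  have : 0 <= Num.sqrt (D / S) * E by rewrite mulr_ge0 ?sqrtr_ge0.
  lra.
rewrite ler_pdivlMr// mulrC (le_trans _ sumD)// /S mulr_suml.
apply: ler_sum => i _.
rewrite ler_pM2l// lerB// ler_sqr ?nnegrE//.
by apply: min_upto_le; rewrite -ltnS.
Qed.

Lemma min_upto_rate u gam (T : nat -> R) (s D E : R) :
  (forall i, 0 <= u i) -> 0 <= E -> (forall i, 0 < gam i) -> 0 <= D -> 0 < s ->
  (forall k, \sum_(i < k) gam i * (u i ^+ 2 - E ^+ 2) <= D) ->
  (\forall k \near \oo, 0 < T k /\ s * T k <= \sum_(i < k.+1) gam i) ->
  \forall k \near \oo,
    min_upto u k <= Num.sqrt (D / s) * (1 / Num.sqrt (T k)) + E.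
Proof.
move=> u0 E0 gam0 D0 s0 sumD; apply: filterS => k [Tk sTk].
apply: le_trans (min_upto_le_sqrt u gam D E k u0 E0 gam0 D0 (sumD _)) _.
rewrite lerD2r div1r -sqrtrV ?(ltW Tk)// -sqrtrM ?divr_ge0 ?(ltW s0)//.
rewrite ler_wsqrtr// -mulrA ler_wpM2l// -invfM lef_pV2//.
- by rewrite posrE (lt_le_trans _ sTk)// mulr_gt0.
- by rewrite posrE mulr_gt0.
Qed.

End BestIterate.

Section DivergentSums.
Context {R : realType}.
Implicit Types (u gam : nat -> R).

Lemma partial_sums_unbounded gam (M : R) : (forall i, 0 < gam i) ->
  (\sum_(0 <= k <oo) (gam k)%:E = +oo)%E ->
  \forall k \near \oo, M <= \sum_(i < k.+1) gam i.
Proof.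
move=> gam0 gamoo.
have cv : cvgn (fun k => \sum_(0 <= i < k) (gam i)%:E)%E.
  by apply: is_cvg_nneseries => i _ _; rewrite lee_fin ltW.
move: cv; rewrite /cvg_to gamoo => /cvgeyPge/(_ M) [N _ NM].
exists N => // k /= Nk; have := NM k.+1 (leq_trans Nk (leqnSn k)).
by rewrite sumEFin lee_fin big_mkord.
Qed.

Lemma limn_esup_le_fin u (E : R) :
  (forall e, 0 < e -> \forall k \near \oo, u k <= E + e) ->
  (limn_esup (fun k => (u k)%:E) <= E%:E)%E.
Proof.
move=> uE; apply/lee_addgt0Pr => e e0.
rewrite /limn_esup /limf_esup.
apply: (@le_trans _ _ (ereal_sup [set (u k)%:E | k in [set k | u k <= E + e]])).
  apply: ereal_inf_lbound => /=.
  by exists [set k | u k <= E + e] => //; exact: uE.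
by apply: ub_ereal_sup => _ [k /= uk <-]; rewrite -EFinD lee_fin.
Qed.

Lemma min_upto_limn_esup u gam (D E : R) : (forall i, 0 <= u i) -> 0 <= E ->
  (forall i, 0 < gam i) -> 0 <= D ->
  (forall k, \sum_(i < k) gam i * (u i ^+ 2 - E ^+ 2) <= D) ->
  (\sum_(0 <= k <oo) (gam k)%:E = +oo)%E ->
  (limn_esup (fun k => (min_upto u k)%:E) <= E%:E)%E.
Proof.
move=> u0 E0 gam0 D0 sumD gamoo; apply: limn_esup_le_fin => e e0.
have := partial_sums_unbounded gam ((D + 1) / e ^+ 2) gam0 gamoo.
apply: filterS => k Sk.
apply: le_trans (min_upto_le_sqrt u gam D E k u0 E0 gam0 D0 (sumD _)) _.
rewrite addrC lerD2l -[leRHS](ger0_norm (ltW e0)) -sqrtr_sqr ler_wsqrtr//.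
have S0 : 0 < \sum_(i < k.+1) gam i.
  by apply: lt_le_trans Sk; rewrite divr_gt0 ?exprn_gt0// ltr_wpDl.
rewrite ler_pdivrMr// mulrC -ler_pdivrMr ?exprn_gt0// (le_trans _ Sk)//.
by rewrite ler_pM2r ?invr_gt0 ?exprn_gt0// lerDl.
Qed.

Lemma powR_partial_sum (p : R) (k : nat) : 0 <= p -> p <= 1 ->
  k%:R `^ (1 - p) <= \sum_(i < k.+1) (i.+1%:R `^ p)^-1.
Proof.
move=> p0 p1.
have kp : 0 < (k.+1%:R `^ p : R) by rewrite powR_gt0.
apply: (@le_trans _ _ (k.+1%:R `^ (1 - p))).
  by apply: ge0_ler_powR; rewrite ?subr_ge0 ?nnegrE// ler_nat.
rewrite powRB ?pnatr_eq0 ?implybT// powRr1//.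
rewrite -[k.+1 in X in X / _](card_ord k.+1) mulr_natl -sumr_const.
apply: ler_sum => i _; rewrite lef_pV2 ?posrE ?powR_gt0//.
by apply: ge0_ler_powR; rewrite ?nnegrE// ler_nat.
Qed.

Lemma ln_partial_sum (k : nat) :
  ln (k.+1%:R : R) <= \sum_(i < k) (i.+1%:R)^-1.
Proof.
elim: k => [|k IH]; first by rewrite big_ord0 ln1.
rewrite big_ord_recr/= -lerBlDl; apply: le_trans (lerB (lexx _) IH) _ => {IH}.
have k0 : 0 < k.+1%:R :> R by [].
rewrite -ln_div ?posrE//.
have -> : k.+2%:R / k.+1%:R = 1 + (k.+1%:R)^-1 :> R.
  by rewrite -(natr1 k.+1) mulrDl divff ?gt_eqF// mul1r.
by apply: le_ln1Dx; rewrite (lt_le_trans (ltrN10 _))// invr_ge0 ltW.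
Qed.

Definition rate_growth (p : R) (k : nat) : R :=
  if p == 1 then ln k%:R else k%:R `^ (1 - p).

Lemma rateE (p : R) k : rate p k = 1 / Num.sqrt (rate_growth p k).
Proof. by rewrite /rate /rate_growth; case: ifP. Qed.

Lemma rate_growth_gt0 (p : R) : \forall k \near \oo, 0 < rate_growth p k.
Proof.
exists 2%N => // k /= k2; rewrite /rate_growth; case: ifP => _.
  by rewrite ln_gt0// ltr1n.
by rewrite powR_gt0// ltr0n (leq_trans _ k2).
Qed.

Lemma rate_growth_le_sum (p : R) k : 0 <= p -> p <= 1 ->
  rate_growth p k <= \sum_(i < k.+1) (i.+1%:R `^ p)^-1.
Proof.
move=> p0 p1; rewrite /rate_growth; case: ifPn => [/eqP ->|_]; last first.
  exact: powR_partial_sum.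
under eq_bigr do rewrite powRr1//.
apply: le_trans (ln_partial_sum _); case: k => [|k].
  by rewrite ln0// ln_ge0// ler1n.
by rewrite ler_ln ?posrE// ler_nat (leq_trans (leqnSn _)).
Qed.

Lemma ln_le_sqrt (x : R) : 0 < x -> ln x <= 2 * Num.sqrt x.
Proof.
move=> x0; have s0 : 0 < Num.sqrt x by rewrite sqrtr_gt0.
rewrite -{1}(sqr_sqrtr (ltW x0)) lnXn// [leRHS]mulr_natl lerMn2r/=.
exact/ltW/ln_sublinear.
Qed.

Lemma rate_growth_sublinear (p e : R) : 0 < p -> p <= 1 -> 0 < e ->
  \forall k \near \oo, rate_growth p k <= e * k%:R.
Proof.
move=> p0 p1 e0; rewrite /rate_growth; case: (p == 1).
  have : \forall k \near \oo, 4 / e ^+ 2 <= k%:R :> R by exact: nbhs_infty_ger.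
  apply: filterS => k; rewrite ler_pdivrMr ?exprn_gt0// => ke.
  have k0 : 0 < k%:R :> R.
    rewrite ltr0n lt0n; apply/eqP => k0; move: ke; rewrite k0 mul0r; lra.
  apply: le_trans (ln_le_sqrt _ k0) _.
  rewrite -ler_sqr ?nnegrE ?mulr_ge0 ?(ltW e0) ?sqrtr_ge0//.
  rewrite !exprMn sqr_sqrtr ?ler0n//.
  rewrite [k%:R ^+ 2]expr2 mulrA ler_wpM2r//; lra.
have : \forall k \near \oo, (e^-1) `^ p^-1 + 1 <= k%:R :> R.
  exact: nbhs_infty_ger.
apply: filterS => k ke.
have k0 : 0 < k%:R :> R by apply: lt_le_trans ke; rewrite ltr_wpDl// powR_ge0.
rewrite powRB ?(gt_eqF k0) ?implybT// powRr1 ?ler0n// ler_pdivrMr ?powR_gt0//.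
rewrite mulrAC ler_peMl// -ler_pdivrMl// mulr1.
have -> : e^-1 = ((e^-1) `^ p^-1) `^ p.
  by rewrite -powRrM mulVf ?gt_eqF// powRr1// invr_ge0 ltW.
apply: ge0_ler_powR; rewrite ?nnegrE ?powR_ge0 ?(ltW p0)//.
by apply: le_trans ke; rewrite lerDl.
Qed.

Lemma inv_sqrt_littleo_rate (p : R) : 0 < p -> p <= 1 ->
  (fun k : nat => 1 / Num.sqrt k%:R : R^o) =o_\oo (rate p).
Proof.
move=> p0 p1; apply/eqoP => e e0.
have e2 : 0 < e ^+ 2 by rewrite exprn_gt0.
near=> k.
have Tk : 0 < rate_growth p k by near: k; exact: rate_growth_gt0.
have Tke : rate_growth p k <= e ^+ 2 * k%:R.
  by near: k; exact: rate_growth_sublinear.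
have k0 : 0 < k%:R :> R by rewrite -(pmulr_rgt0 _ e2) (lt_le_trans Tk).
rewrite rateE !div1r !ger0_norm ?invr_ge0 ?sqrtr_ge0//.
rewrite ler_pdivlMr ?sqrtr_gt0// mulrC ler_pdivrMr ?sqrtr_gt0//.
rewrite -[e](ger0_norm (ltW e0)) -sqrtr_sqr -sqrtrM ?(ltW e2)//.
exact: ler_wsqrtr.
Unshelve. all: by end_near.
Qed.

End DivergentSums.

Lemma min_const_le {R : realType} {m : nat} (hm : (2 <= m)%N)
    (mu : 'I_m -> R) i :
  min_const hm mu <= mu i.
Proof. exact: (bigmin_inf i). Qed.

Lemma min_const_gt0 {R : realType} {m : nat} (hm : (2 <= m)%N)
    (mu : 'I_m -> R) :
  (forall i, 0 < mu i) -> 0 < min_const hm mu.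
Proof. by move=> mu0; apply: lt_bigmin. Qed.

Theorem corollary1 (R : realType) (m n : nat) (hm : (2 <= m)%N) (hn : (1 <= n)%N)
    (Y : set 'rV[R]_n) (hY0 : Y !=set0) (hYcl : closed Y) (hYcv : convex_set Y)
    (f : 'I_m -> 'rV[R]_n -> R)
    (hfs : forall i, strictly_convex (f i))
    (hfc : forall i, closed_function (f i))
    (mu : 'I_m -> R) (hmu : forall i, 0 < mu i)
    (hfmu : forall i, strongly_convex (mu i) (f i))
    (eps : 'I_m -> R) (gam : nat -> R)
    (lam : nat -> 'M[R]_(m.-1, n)) (y r : nat -> 'M[R]_(m, n))
    (hrun : inexact_dual_run f Y gam lam y r)
    (hr : forall k i, enorm (row i (r k)) <= eps i)
    (hgam : forall k, 0 < gam k /\ gam k <= 1 / lip_const hm mu)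
    (hgamsum : (\sum_(0 <= k <oo) (gam k)%:E = +oo)%E) :
  let best := min_upto (fun i => enorm (gradient (neg_dual f Y) (lam i))) in
  [/\ (limn_esup (fun k => (best k)%:E) <= (total_eps eps)%:E)%E,
      forall gamma p : R, 0 < gamma -> gamma <= 1 / lip_const hm mu ->
        0 <= p -> p <= 1 ->
        (forall k, gam k = gamma / (k.+1%:R `^ p)) ->
        exists C : R, \forall k \near \oo,
          best k <= C * rate p k + total_eps eps,
      forall p : R, 0 < p -> p <= 1 ->
        (fun k : nat => 1 / Num.sqrt k%:R : R^o) =o_\oo (rate p)
    & forall gamma : R, 0 < gamma -> gamma <= 1 / lip_const hm mu ->
        (forall k, gam k = gamma) ->
        exists C : R, \forall k \near \oo,
          best k <= C * (1 / Num.sqrt k%:R) + total_eps eps].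
Proof.
move=> best.
set L := lip_const hm mu.
have mc0 := min_const_gt0 hm mu hmu.
have [gam0 gamL] : (forall k, 0 < gam k) /\ (forall k, gam k <= 1 / L).
  by split=> k; have [] := hgam k.
have L0 : 0 < L.
  by have := lt_le_trans (gam0 0%N) (gamL 0%N); rewrite div1r invr_gt0.
have cL : 2 + 2 * cos (pi / m%:R) <= min_const hm mu * L.
  by rewrite /L /lip_const mulrA div1r divff ?gt_eqF// mul1r.
have rE k : enorm (diffop (r k)) <= total_eps eps.
  exact: enorm_diffop_le_total_eps (hr k).
have gamL1 k : 0 < gam k /\ gam k * L <= 1 by rewrite -ler_pdivlMr.
have [D D0 sumD] := run_sum_bound f Y hY0 hYcv mu hfmu _ L (min_const_le hm mu)
  L0 cL gam lam y r _ hrun rE gamL1.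
have E0 : 0 <= total_eps eps by exact: sqrtr_ge0.
have u0 i : 0 <= enorm (gradient (neg_dual f Y) (lam i)) by exact: enorm_ge0.
have power_rate gamma p : 0 < gamma -> 0 <= p -> p <= 1 ->
    (forall k, gam k = gamma / (k.+1%:R `^ p)) ->
    exists C : R, \forall k \near \oo, best k <= C * rate p k + total_eps eps.
  move=> gamma0 p0 p1 gamE; exists (Num.sqrt (D / gamma)).
  under eq_near do rewrite rateE.
  apply: min_upto_rate sumD _ => //.
  apply: filterS (rate_growth_gt0 p) => k Tk; split=> //.
  under eq_bigr do rewrite gamE.
  by rewrite -mulr_sumr ler_pM2l// rate_growth_le_sum.
split.
- exact: min_upto_limn_esup sumD hgamsum.
- by move=> gamma p gamma0 _; exact: power_rate.
- exact: inv_sqrt_littleo_rate.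
- move=> gamma gamma0 _ gamE.
  have [|C HC] := power_rate gamma 0 gamma0 (lexx 0) ler01.
    by move=> k; rewrite powRr0 divr1.
  exists C; move: HC; apply: filterS => k.
  by rewrite /rate eq_sym oner_eq0 subr0 powRr1.
Qed.
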